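(* The complementary prism $K_n\overline{K_n}$ of the complete graph $K_n$ on $n$ vertices admits perfect pair state transfer with respect to the signless Laplacian matrix if and only if $n=2$.
   Context: The complementary prism $G\overline{G}$ of a graph $G$ is obtained from the disjoint union of $G$ and its complement $\overline{G}$ (vertices relabelled $a'$ for $a\in V(G)$) by adding an edge between each vertex $a$ of $G$ and its copy $a'$ in $\overline{G}$. The signless Laplacian matrix is $Q=D+A$, with $A$ the adjacency matrix and $D$ the diagonal degree matrix. For a real symmetric matrix $M$ associated with a graph, $U_M(t)=\exp(itM)$. There is perfect state transfer between two linearly independent real unit vectors $\mathbf{u},\mathbf{v}$ with respect to $M$ if there exist $\tau>0$ and $\gamma\in\mathbb{C}$ with $|\gamma|=1$ such that $U_M(\tau)\mathbf{u}=\gamma\mathbf{v}$. A pair state is a vector $\frac{1}{\sqrt2}(\mathbf{e}_x-\mathbf{e}_y)$ with $x\ne y$ vertices of the graph, where $\mathbf{e}_x$ is the characteristic vector of $x$. A graph admits perfect pair state transfer if there is perfect state transfer between some two (linearly independent) pair states. *)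

(* Defs.v *)
(* MathComp / MathComp-Analysis, over an arbitrary real number type
   [R : realType]; the complex numbers are [R[i]]. *)
From mathcomp Require Import all_boot all_order all_algebra.
From mathcomp Require Import all_classical all_reals all_analysis.
From mathcomp Require Import complex.

Set Implicit Arguments.
Unset Strict Implicit.
Unset Printing Implicit Defensive.

Import Order.TTheory GRing.Theory Num.Theory.
Import numFieldNormedType.Exports.

Local Open Scope classical_set_scope.
Local Open Scope ring_scope.
Local Open Scope complex_scope.

Record sgraph := SGraph {
  vertex :> finType;
  adj : rel vertex;
  adj_sym : symmetric adj;
  adj_irr : irreflexive adj }.

Section Complement.
Variable G : sgraph.

Definition compl_adj : rel G := fun x y => (x != y) && ~~ adj x y.

Lemma compl_adj_sym : symmetric compl_adj.
Proof. by move=> x y; rewrite /compl_adj eq_sym adj_sym. Qed.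

Lemma compl_adj_irr : irreflexive compl_adj.
Proof. by move=> x; rewrite /compl_adj eqxx. Qed.

Definition complement : sgraph := SGraph compl_adj_sym compl_adj_irr.

(* [inl a] is the vertex a of G and [inr a] is its copy a' in the complement. *)
Definition cprism_adj : rel (vertex G + vertex complement)%type := fun u v =>
  match u, v with
  | inl a, inl b => @adj G a b
  | inr a, inr b => @adj complement a b
  | inl a, inr b => a == b
  | inr a, inl b => a == b
  end.

Lemma cprism_adj_sym : symmetric cprism_adj.
Proof. case=> a [] b /=.
- exact: adj_sym.
- exact: eq_sym.
- exact: eq_sym.
- exact: compl_adj_sym.
Qed.

Lemma cprism_adj_irr : irreflexive cprism_adj.
Proof. by case=> a /=; [exact: adj_irr | exact: compl_adj_irr]. Qed.

Definition complementary_prism : sgraph := SGraph cprism_adj_sym cprism_adj_irr.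

End Complement.

Section CompleteGraph.
Variable n : nat.

Definition complete_adj : rel 'I_n := fun x y => x != y.

Lemma complete_adj_sym : symmetric complete_adj.
Proof. by move=> x y; rewrite /complete_adj eq_sym. Qed.

Lemma complete_adj_irr : irreflexive complete_adj.
Proof. by move=> x; rewrite /complete_adj eqxx. Qed.

Definition complete_graph : sgraph := SGraph complete_adj_sym complete_adj_irr.

End CompleteGraph.

(* Matrices and vectors indexed by the vertices of G use the enumeration
   [enum_val : 'I_#|G| -> G] of the vertex set and its inverse [enum_rank]. *)
Section GraphMatrices.
Variables (R : realType) (G : sgraph).

Definition degree (x : G) : nat := #|[pred y | adj x y]|.

Definition adjacency_mx : 'M[R]_#|G| :=
  \matrix_(i, j) (adj (enum_val i) (enum_val j))%:R.

Definition degree_mx : 'M[R]_#|G| :=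
  diag_mx (\row_i (degree (enum_val i))%:R).

Definition signless_laplacian : 'M[R]_#|G| := degree_mx + adjacency_mx.

Definition char_vec (x : G) : 'cV[R]_#|G| := delta_mx (enum_rank x) 0.

Definition pair_state (x y : G) : 'cV[R]_#|G| :=
  (Num.sqrt 2)^-1 *: (char_vec x - char_vec y).

End GraphMatrices.

Section StateTransfer.
Variables (R : realType) (n : nat).

(* exp(A) = sum_k A^k / k!, the limit of the partial sums being taken entrywise.
   The cast to [R[i]^o] selects the topology of R[i] given by the modulus. *)
Definition mxexp (A : 'M[R[i]]_n) : 'M[R[i]]_n :=
  \matrix_(x, y)
    (lim ((fun m => \sum_(k < m) (k`!%:R^-1 *: A ^+ k) x y : R[i]^o) @ \oo)
     : R[i]).

Definition complex_mx m p (B : 'M[R]_(m, p)) : 'M[R[i]]_(m, p) :=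
  map_mx (fun r : R => r%:C) B.

(* U_M(t) = exp(i t M) *)
Definition transition_mx (M : 'M[R]_n) (t : R) : 'M[R[i]]_n :=
  mxexp (('i * t%:C) *: complex_mx M).

Definition unit_vec (u : 'cV[R]_n) : Prop := \sum_j u j 0 ^+ 2 = 1.

Definition perfect_state_transfer (M : 'M[R]_n) (u v : 'cV[R]_n) : Prop :=
  [/\ unit_vec u, unit_vec v, free [:: u; v] &
      exists (tau : R) (gamma : R[i]),
        [/\ 0 < tau, `|gamma| = 1 &
            transition_mx M tau *m complex_mx u = gamma *: complex_mx v]].

End StateTransfer.

Definition admits_perfect_pair_state_transfer (R : realType) (G : sgraph)
    (M : 'M[R]_#|G|) : Prop :=
  exists x y z w : G,
    [/\ x != y, z != w &
        perfect_state_transfer M (pair_state R x y) (pair_state R z w)].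

(* Main.v *)
Require Import Defs.
From mathcomp Require Import all_boot all_order all_algebra.
From mathcomp Require Import all_classical all_reals all_analysis.
From mathcomp Require Import complex zify ring lra.

(** On the vectors whose entries sum to zero over each of the two copies of the
    vertex set, the signless Laplacian [Q] of the prism acts as the 2 x 2 matrix
    [[n - 1, 1], [1, 1]].  Hence, if [D] sums to zero and [eta] is a root of
    [eta^2 = (n - 2) eta + 1], the vector equal to [eta D] on the complete graph
    and to [D] on the edgeless copy is an eigenvector of [Q], with eigenvalue
    [eta + 1] ([prism_eigenvector]).

    Let [U = exp(i tau Q)], and suppose that [U u = gamma v] with [u], [v] pair
    states.  As [U] is symmetric, pairing with the eigenvector [w] obtained from
    [D = e_i - e_j] gives [exp(i tau (eta + 1)) <w, u> = gamma <w, v>], with both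
    inner products real.  Where these do not vanish, the ratio of the two phases
    is real of modulus one, so one sign [e = 1] or [e = -1] satisfies
    [<w, v> = e <w, u>] for all [i] and [j].  Up to the common factor
    [1 / sqrt 2], each of these products has the form [eta a + b] with [a], [b]
    integers, namely the differences between positions [i] and [j] on the two
    copies.  When [n >= 3], the root [eta] is irrational, because
    [(n - 2)^2 + 4] is not a square ([sum_int_eq0]); so the differences of [v]
    are [e] times those of [u] on each copy.  A constant shift on a
    copy is impossible, since the entries of a pair state are too constrained
    ([pair_like_eq]); so [v = e u] and the two states are linearly dependent
    ([transfer_target_dependent]).  For [n <= 1] there is at most one pair state
    up to sign.

    For [n = 2] the two roots are [1] and [-1], with eigenvalues [2] and [0], so
    at time [pi / 2] one eigenvector changes sign and the other is fixed; this
    carries [e_x - e_y] on one copy to [-(e_x - e_y)] on the other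
    ([transfer_prism2]).

    The exponential itself is handled through its real and imaginary parts: its
    entries are [C + i S], where [C] and [S] are the cosine and sine series of the
    real matrix [tau Q], which converge absolutely and act on an eigenvector by the
    cosine and the sine of the eigenvalue ([transition_mx_eigen]). *)

Set Implicit Arguments.
Unset Strict Implicit.
Unset Printing Implicit Defensive.

Import Order.TTheory GRing.Theory Num.Theory.
Import numFieldNormedType.Exports.

Local Open Scope classical_set_scope.
Local Open Scope ring_scope.
Local Open Scope complex_scope.

(** * The transition matrix on eigenvectors *)

Section Evolution.
Variable R : realType.

Lemma cvg_complex (u v : R^nat) (a b : R) :
  u @ \oo --> a -> v @ \oo --> b ->
  (fun m => u m +i* v m : R[i]^o) @ \oo --> (a +i* b : R[i]^o).
Proof.
move=> ua vb; apply/cvgrPdist_lt => -[e e'] /[dup] e0.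
rewrite ltcE /= => /andP[/eqP e'0 egt0]; rewrite {e'}e'0 in e0 *.
have e2 : 0 < e / 2 by rewrite divr_gt0.
near=> m.
have um : `|a - u m| < e / 2.
  by near: m; move/cvgrPdist_lt: ua; apply.
have vm : `|b - v m| < e / 2.
  by near: m; move/cvgrPdist_lt: vb; apply.
rewrite -[_ - _]/((a - u m) +i* (b - v m)) normc_def /= ltcR.
rewrite (le_lt_trans (y := `|a - u m| + `|b - v m|)) //; last by lra.
rewrite -[leRHS]ger0_norm ?addr_ge0// -sqrtr_sqr ler_wsqrtr//.
rewrite -(real_normK (num_real (a - u m))) -(real_normK (num_real (b - v m))).
have := normr_ge0 (a - u m); have := normr_ge0 (b - v m); nra.
Unshelve. all: by end_near. Qed.

Lemma norm_cos_coeff_le (t : R) k : `|cos_coeff t k| <= exp_coeff `|t| k.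
Proof.
rewrite /cos_coeff /exp_coeff /= -exprnP !normrM normfV !normrX normrN1 expr1n.
rewrite mulr1 !normr_nat -[leRHS]mul1r -mulrA ler_wpM2r//.
by case: odd.
Qed.

Lemma norm_sin_coeff_le (t : R) k : `|sin_coeff t k| <= exp_coeff `|t| k.
Proof.
rewrite /sin_coeff /exp_coeff /= !normrM normfV !normrX normrN1 expr1n.
rewrite mulr1 !normr_nat -[leRHS]mul1r -mulrA ler_wpM2r//.
by case: odd.
Qed.

(** The powers of ['i] have period four, and the definitions of the cosine and
    sine coefficients encode exactly their real and imaginary parts. *)
Lemma expi_coeff (t : R) k :
  k`!%:R^-1 * ('i * t%:C) ^+ k = cos_coeff t k +i* sin_coeff t k :> R[i].
Proof.
have iX j : ('i : R[i]) ^+ j.*2 = ((-1) ^+ j)%:C.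
  by rewrite -mul2n exprM sqr_i rmorphXn rmorphN1.
rewrite exprMn -rmorphXn -[k`!%:R](rmorph_nat (real_complex R)) -fmorphV.
rewrite /cos_coeff /sin_coeff /= -exprnP.
have /esym := odd_double_half k; case: (odd k) => /= kE.
  rewrite [in 'i ^+ k]kE [in k.-1]kE exprS iX /= doubleK; simpc.
  by congr (_ +i* _); ring.
rewrite [in 'i ^+ k]kE iX; simpc.
by congr (_ +i* _); ring.
Qed.

Variables (n : nat) (M : 'M[R]_n).

(** The sum of the absolute values of all entries is a submultiplicative norm,
    hence a bound as stated; it makes the series below converge by comparison
    with the exponential series. *)
Lemma expmx_entry_bound :
  exists2 C : R, 0 <= C & forall k x y, `|(M ^+ k) x y| <= C ^+ k.
Proof.
pose C := \sum_x \sum_y `|M x y|.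
have C0 : 0 <= C by apply: sumr_ge0 => x _; apply: sumr_ge0.
exists C => // k; elim: k => [|k IH] x y.
  rewrite !expr0 mxE; case: (x == y) => //=; by rewrite ?normr1 ?normr0.
rewrite !exprS -mulmxE mxE (le_trans (ler_norm_sum _ _ _))//.
apply: (@le_trans _ _ (\sum_z `|M x z| * C ^+ k)).
  by apply: ler_sum => z _; rewrite normrM ler_wpM2l.
rewrite -mulr_suml ler_wpM2r ?exprn_ge0//.
by rewrite [leRHS](bigD1 x)//= lerDl sumr_ge0// => z _; apply: sumr_ge0.
Qed.

Definition mxseries (c : R^nat) : 'M[R]_n :=
  \matrix_(x, y) limn (series (fun k => c k * (M ^+ k) x y)).

Variable t : R.

Lemma is_cvg_mxseries (c : R^nat) x y :
  (forall k, `|c k| <= exp_coeff `|t| k) ->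
  cvgn (series (fun k => c k * (M ^+ k) x y)).
Proof.
move=> ct; have [C C0 MC] := expmx_entry_bound.
apply: normed_cvg; apply: series_le_cvg (is_cvg_series_exp_coeff (`|t| * C)).
- by move=> k; exact: normr_ge0.
- by move=> k; rewrite exp_coeff_ge0// mulr_ge0.
- move=> k; rewrite /= normrM (le_trans (ler_pM _ _ (ct k) (MC k x y)))//.
  by rewrite /exp_coeff/= exprMn mulrAC.
Qed.

(** On an eigenvector each power of [M] is a scalar, so the matrix series
    collapses to the scalar series of the eigenvalue. *)
Lemma mxseries_eigen (c d : R^nat) (theta l : R) (w : 'cV[R]_n) :
  (forall k, `|c k| <= exp_coeff `|t| k) ->
  (forall k, c k * theta ^+ k = d k) -> series d @ \oo --> l ->
  M *m w = theta *: w -> mxseries c *m w = l *: w.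
Proof.
move=> ct cd dl Mw.
have Mkw k : M ^+ k *m w = theta ^+ k *: w.
  elim: k => [|k IH]; first by rewrite !expr0 mul1mx scale1r.
  by rewrite exprSr -mulmxE -mulmxA Mw -scalemxAr IH scalerA -exprS.
apply/matrixP => x j; rewrite !mxE.
have L : (fun m => \sum_y series (fun k => c k * (M ^+ k) x y) m * w y j) @ \oo
    --> \sum_y mxseries c x y * w y j.
  apply: cvg_big => [|y _]; first exact: add_continuous.
  apply: cvgMr_tmp.
  rewrite mxE; exact: is_cvg_mxseries.
apply: (cvg_unique _ L) => //.
rewrite (_ : (fun m => _) = fun m => series d m * w x j).
  by apply: cvgMr_tmp.
apply/funext => m; rewrite /series /= mulr_suml.
under eq_bigr do rewrite mulr_suml.
rewrite exchange_big /=; apply: eq_bigr => k _.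
have /matrixP/(_ x j) := Mkw k; rewrite !mxE => Mk.
by rewrite -cd -mulrA -Mk mulr_sumr; apply: eq_bigr => y _; rewrite mulrA.
Qed.

Lemma transition_mxE :
  transition_mx M t =
    complex_mx (mxseries (cos_coeff t)) + 'i *: complex_mx (mxseries (sin_coeff t)).
Proof.
apply/matrixP => x y; rewrite [LHS]mxE !mxE.
rewrite (_ : _ + _ = limn (series (fun k => cos_coeff t k * (M ^+ k) x y)) +i*
             limn (series (fun k => sin_coeff t k * (M ^+ k) x y))); last by simpc.
apply: (@cvg_lim R[i]^o); first exact: norm_hausdorff.
have -> : (fun m => \sum_(k < m)
    (k`!%:R^-1 *: (('i * t%:C) *: complex_mx M) ^+ k) x y : R[i]^o) =
   (fun m => series (fun k => cos_coeff t k * (M ^+ k) x y) m +i*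
             series (fun k => sin_coeff t k * (M ^+ k) x y) m).
  have MX k : (('i * t%:C) *: complex_mx M) ^+ k =
      ('i * t%:C) ^+ k *: complex_mx (M ^+ k).
    elim: k => [|k IH]; first by rewrite !expr0 scale1r /complex_mx map_mx1.
    by rewrite !exprS IH -!mulmxE /complex_mx map_mxM -scalemxAl -scalemxAr scalerA.
  apply/funext; elim=> [|m IH]; first by rewrite /series /= big_ord0 !big_nil.
  rewrite big_ord_recr /= {}IH /series /= !big_nat_recr//=.
  rewrite MX !mxE mulrA expi_coeff.
  by simpc.
apply: cvg_complex; apply: is_cvg_mxseries.
  exact: norm_cos_coeff_le.
exact: norm_sin_coeff_le.
Qed.

Lemma transition_mx_eigen theta (w : 'cV[R]_n) : M *m w = theta *: w ->
  transition_mx M t *m complex_mx w =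
    (cos (t * theta) +i* sin (t * theta)) *: complex_mx w.
Proof.
move=> Mw; rewrite transition_mxE mulmxDl -scalemxAl /complex_mx -!map_mxM.
rewrite (@mxseries_eigen _ (cos_coeff (t * theta)) theta (cos (t * theta)))//.
- rewrite (@mxseries_eigen _ (sin_coeff (t * theta)) theta (sin (t * theta)))//.
  + by apply/matrixP => x j; rewrite !mxE; simpc.
  + exact: norm_sin_coeff_le.
  + by move=> k; rewrite /sin_coeff/= exprMn; ring.
  + rewrite unlock; exact: is_cvg_series_sin_coeff.
- exact: norm_cos_coeff_le.
- by move=> k; rewrite /cos_coeff/= exprMn; ring.
- rewrite unlock; exact: is_cvg_series_cos_coeff.
Qed.

Lemma tr_transition_mx : M^T = M -> (transition_mx M t)^T = transition_mx M t.
Proof.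
move=> MT; have MkT k : (M ^+ k)^T = M ^+ k.
  elim: k => [|k IH]; first by rewrite expr0 trmx1.
  by rewrite exprS -mulmxE trmx_mul MT IH mulmxE -exprSr exprS.
have ST c : (mxseries c)^T = mxseries c.
  apply/matrixP => x y; rewrite !mxE; congr (limn (series _)).
  by apply/funext => k; rewrite -[in LHS]MkT mxE.
by rewrite transition_mxE linearD linearZ /= /complex_mx !map_trmx !ST.
Qed.

(** Pairing [U u = gamma v] with an eigenvector [w] and moving the symmetric
    matrix [U] onto [w] gives a conservation law for the component along [w]. *)
Lemma transfer_eigen theta (w u v : 'cV[R]_n) (gamma : R[i]) :
  M^T = M -> M *m w = theta *: w ->
  transition_mx M t *m complex_mx u = gamma *: complex_mx v ->
  (cos (t * theta) +i* sin (t * theta)) * ((w^T *m u) 0 0)%:C =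
    gamma * ((w^T *m v) 0 0)%:C.
Proof.
move=> MT Mw Uu.
have wU : (complex_mx w)^T *m transition_mx M t =
    (cos (t * theta) +i* sin (t * theta)) *: (complex_mx w)^T.
  by rewrite -(tr_transition_mx MT) -trmx_mul (transition_mx_eigen Mw) linearZ.
have := congr1 (mulmx (complex_mx w)^T) Uu.
rewrite mulmxA wU -scalemxAl -scalemxAr /complex_mx map_trmx -!map_mxM.
by move=> /matrixP/(_ 0 0); rewrite !mxE.
Qed.

End Evolution.

(** * Vectors as functions on the vertices *)

Section VertexFunctions.
Variables (R : realType) (G : sgraph).

Definition vertex_vec (f : G -> R) : 'cV[R]_#|G| := \col_i f (enum_val i).

Lemma sum_enum_val (F : G -> R) : \sum_(i < #|G|) F (enum_val i) = \sum_x F x.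
Proof. by rewrite [RHS](reindex _ (onW_bij _ (@enum_val_bij G))). Qed.

Lemma tr_signless_laplacian :
  (signless_laplacian R G)^T = signless_laplacian R G.
Proof.
rewrite /signless_laplacian linearD /= /degree_mx tr_diag_mx; congr (_ + _).
by apply/matrixP => i j; rewrite !mxE adj_sym.
Qed.

(** The degree term is one copy of [f x] for each neighbour of [x]. *)
Lemma signless_laplacian_mul f :
  signless_laplacian R G *m vertex_vec f =
    vertex_vec (fun x => \sum_(y | adj x y) (f x + f y)).
Proof.
apply/matrixP => i j; rewrite mulmxDl mul_diag_mx !mxE big_split /=.
congr (_ + _); first by rewrite sumr_const mulr_natl.
rewrite [RHS]big_mkcond -sum_enum_val; apply: eq_bigr => k _; rewrite !mxE.
by case: adj; rewrite ?mul1r ?mul0r.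
Qed.

(** A pair state without its factor [1 / sqrt 2], kept over the integers for the
    irrationality argument. *)
Definition vertex_diff (x y : G) : G -> int := fun t => (t == x)%:R - (t == y)%:R.

Lemma pair_stateE (x y : G) : pair_state R x y =
  (Num.sqrt 2)^-1 *: vertex_vec (fun t => (vertex_diff x y t)%:~R).
Proof.
congr (_ *: _); apply/matrixP => i j; rewrite !mxE (ord1 j) !andbT.
rewrite intrB !mulrz_nat.
by rewrite !(can2_eq (@enum_valK G) (@enum_rankK G)).
Qed.

Lemma vertex_vec_pair_state f (x y : G) :
  ((vertex_vec f)^T *m pair_state R x y) 0 0 = (Num.sqrt 2)^-1 * (f x - f y).
Proof.
rewrite -scalemxAr !mxE; congr (_ * _).
under eq_bigr do rewrite !mxE !andbT mulrBr.
have E z : \sum_(j < #|G|) f (enum_val j) * (j == enum_rank z)%:R = f z.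
  rewrite (bigD1 (enum_rank z))//= eqxx enum_rankK mulr1 big1 ?addr0//.
  by move=> k /negPf ->; rewrite mulr0.
by rewrite big_split/= sumrN !E.
Qed.

End VertexFunctions.

(** * Irrationality and rigidity *)

(** The discriminant [m^2 + 4] lies strictly between [m^2] and [(m + 2)^2], and
    it is not [(m + 1)^2] for reasons of parity, so it is not a square. *)
Lemma quadratic_int_eq0 (m : nat) (a b : int) : (0 < m)%N ->
  b ^+ 2 + m%:Z * a * b = a ^+ 2 -> a = 0 /\ b = 0.
Proof.
move=> m0 ab; have [a0|a0] := eqVneq a 0.
  split=> //; move: ab; rewrite a0 mulr0 mul0r addr0 => /eqP.
  by rewrite expr0n sqrf_eq0 => /eqP.
exfalso.
pose A := `|a|%N; pose c := `|(2 * b + m%:Z * a)%R|%N.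
have sqr : (2 * b + m%:Z * a) ^+ 2 = (m%:Z ^+ 2 + 4) * a ^+ 2.
  transitivity (4 * (b ^+ 2 + m%:Z * a * b) + m%:Z ^+ 2 * a ^+ 2); first ring.
  by rewrite ab; ring.
(* Completing the square shows that [a^2] divides the square [c^2]. *)
have cA : (c ^ 2 = (m ^ 2 + 4) * A ^ 2)%N.
  by have := congr1 absz sqr; rewrite abszM !abszX.
have /dvdnP[k ck] : (A %| c)%N by rewrite -(@dvdn_pexp2r _ _ 2)// cA dvdn_mull.
have A0 : (0 < A)%N by rewrite absz_gt0.
have km : (k ^ 2 = m ^ 2 + 4)%N.
  by apply/eqP; rewrite -(@eqn_pmul2r (A ^ 2)) ?expn_gt0 ?A0// -expnMn -ck cA.
rewrite -!mulnn in km.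
have mk : (m < k)%N.
  by rewrite ltnNge; apply/negP => mk'; have := leq_mul mk' mk'; lia.
have [k1|k2] : k = m.+1 \/ (m.+2 <= k)%N by lia.
  by move: km; rewrite k1; lia.
by have := leq_mul k2 k2; lia.
Qed.

(** Irrationality of the roots of [X^2 - m X - 1]. *)
Lemma sum_int_eq0 (R : realType) (m : nat) (eta : R) (a b : int) : (0 < m)%N ->
  eta ^+ 2 = m%:R * eta + 1 -> eta * a%:~R + b%:~R = 0 -> a = 0 /\ b = 0.
Proof.
move=> m0 etaE /eqP; rewrite addr_eq0 => /eqP ab.
apply: (@quadratic_int_eq0 m) => //; apply: (@intr_inj R).
rewrite !(rmorphD, rmorphM, rmorphXn) /= -pmulrn.
have -> : (b%:~R : R) = - (eta * a%:~R) by rewrite ab opprK.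
rewrite sqrrN exprMn etaE; ring.
Qed.

Lemma unit_real_ratio (R : realType) (k : R[i]) (r s : R) :
  `|k| = 1 -> k * r%:C = s%:C -> r != 0 -> exists2 e : int,
  e = 1 \/ e = -1 & k = (e%:~R)%:C.
Proof.
move=> k1 krs r0.
have kE : k = (s / r)%:C.
  by rewrite rmorphM /= -krs fmorphV mulfK// (inj_eq (@complexI R) r 0).
move: k1; rewrite kE normc_def /= expr0n addr0 sqrtr_sqr => /(@complexI R).
case: (real_ge0P (num_real (s / r))) => _ sr.
  by exists 1; [left | rewrite sr].
by exists (-1); [right | rewrite mulrN1z -sr opprK].
Qed.

(** What is needed about a restriction of [vertex_diff]: the values are [0], [1]
    and [-1], and each nonzero value is taken at most once. *)
Definition pair_like (T : eqType) (f : T -> int) :=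
  (forall t, -1 <= f t <= 1) /\ (forall s t, s != t -> f s = f t -> f s = 0).

Lemma vertex_diff_pair_like (G : sgraph) (x y : G) : x != y ->
  pair_like (vertex_diff x y).
Proof.
move=> xy; rewrite /vertex_diff; split=> [t|s t st].
  by case: (t == x); case: (t == y).
case: (eqVneq s x) => [sx|_]; case: (eqVneq s y) => [sy|_] //.
  by rewrite -sx eq_sym (negPf st); case: (t == y).
by rewrite -sy (eq_sym t s) (negPf st); case: (t == x).
Qed.

Lemma pair_like_inj (T T' : eqType) (i : T -> T') (f : T' -> int) :
  injective i -> pair_like f -> pair_like (f \o i).
Proof.
move=> i_inj [fb f0]; split=> [t|s t st]; first exact: fb.
by apply: f0; rewrite (inj_eq i_inj).
Qed.

Lemma exists_avoid2 (n : nat) (i j : 'I_n) : (2 < n)%N ->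
  exists2 k, k != i & k != j.
Proof.
move=> n3; have : (0 < #|~: [set i; j]|)%N.
  rewrite cardsCs finset.setCK card_ord subn_gt0 (leq_ltn_trans _ n3)// cards2.
  by case: (i != j).
by move=> /card_gt0P[k]; rewrite !inE negb_or => /andP[ki kj]; exists k.
Qed.

(** The hypothesis says that [g = e f + c] with [c] constant.  Among three
    points, either [f] vanishes at two, where [g] then repeats the value [c], or
    [f] takes the values [1] and [-1], so that [c + 1] and [c - 1] are values of
    [g]; in both cases [c = 0]. *)
Lemma pair_like_eq (n : nat) (f g : 'I_n -> int) (e : int) : (2 < n)%N ->
  e = 1 \/ e = -1 -> pair_like f -> pair_like g ->
  (forall i j, g i - g j = e * (f i - f j)) -> forall i, g i = e * f i.
Proof.
move=> n3 e1 [fb f0] [gb g0] gf i.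
have [j ji _] := exists_avoid2 i i n3.
have [k ki kj] := exists_avoid2 i j n3.
have := f0 _ _ ji; have := f0 _ _ ki; have := f0 _ _ kj.
have := g0 _ _ ji; have := g0 _ _ ki; have := g0 _ _ kj.
have := gf i j; have := gf i k.
have := fb i; have := fb j; have := fb k.
have := gb i; have := gb j; have := gb k.
case: e1 => ->; lia.
Qed.

(** * The complementary prism of the complete graph *)

Section Prism.
Variables (R : realType) (n : nat).

Let G := complementary_prism (complete_graph n).
Let Q := signless_laplacian R G.

Definition prism_fun (eta : R) (D : 'I_n -> R) : G -> R :=
  fun t => match t with inl a => eta * D a | inr a => D a end.

(** On the complete graph, the edges from [a] to its [n - 1] neighbours contribute
    [(n - 1) eta D a] and, as [D] sums to zero, [- eta D a]; the edge to the copy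
    adds [(eta + 1) D a].  The equation on [eta] makes the total a multiple of
    [eta D a]. *)
Lemma prism_eigenvector eta D :
  eta ^+ 2 = (n%:R - 2) * eta + 1 -> \sum_i D i = 0 ->
  Q *m vertex_vec (prism_fun eta D) = (eta + 1) *: vertex_vec (prism_fun eta D).
Proof.
move=> etaE D0; rewrite signless_laplacian_mul.
apply/matrixP => i j; rewrite !mxE.
case: (enum_val i) => a; rewrite big_sumType /=.
  rewrite [X in _ + X](eq_bigl (pred1 a)); last by move=> b; rewrite /= eq_sym.
  rewrite big_pred1_eq /=.
  have -> : \sum_(b | complete_adj a b) (eta * D a + eta * D b) =
      (n%:R - 2) * (eta * D a).
    have := D0; rewrite (bigD1 a)//= => /eqP; rewrite addrC addr_eq0 => /eqP Da.
    rewrite (eq_bigl (fun b => b != a)) /=; last first.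
      by move=> b; rewrite /complete_adj eq_sym.
    rewrite big_split /= sumr_const -mulr_sumr Da cardC1 card_ord -subn1.
    rewrite -[_ *+ (n - 1)]mulr_natl natrB; first ring.
    exact: leq_ltn_trans (leq0n a) (ltn_ord a).
  transitivity (eta ^+ 2 * D a + eta * D a); last by ring.
  by rewrite etaE; ring.
rewrite [X in _ + X]big_pred0; last first.
  by move=> b; rewrite /compl_adj /= /complete_adj negbK; case: eqVneq.
rewrite (eq_bigl (pred1 a)); last by move=> b; rewrite /= eq_sym.
rewrite big_pred1_eq addr0; ring.
Qed.

Definition point_diff (i j : 'I_n) : 'I_n -> R :=
  fun k => (k == i)%:R - (k == j)%:R.

Lemma sum_point_diff i j : \sum_k point_diff i j k = 0.
Proof.
have E k : \sum_(l < n) ((l == k)%:R : R) = 1.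
  by rewrite (bigD1 k)//= eqxx big1 ?addr0// => l /negPf ->.
by rewrite big_split /= sumrN !E subrr.
Qed.

(** Reading the pairing of the eigenvector with a pair state as a function of the
    state: an integer combination of [eta] and [1]. *)
Lemma prism_fun_pair eta i j (x y : G) :
  prism_fun eta (point_diff i j) x - prism_fun eta (point_diff i j) y =
  eta * (vertex_diff x y (inl i) - vertex_diff x y (inl j))%:~R +
  (vertex_diff x y (inr i) - vertex_diff x y (inr j))%:~R.
Proof.
rewrite /vertex_diff !rmorphB /= !mulrz_nat.
case: x y => a [] b; rewrite /prism_fun /point_diff /eq_op /=;
  by rewrite !(eq_sym i) !(eq_sym j); ring.
Qed.

Lemma transfer_components tau gamma eta i j (x y z w : G) :
  eta ^+ 2 = (n%:R - 2) * eta + 1 ->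
  transition_mx Q tau *m complex_mx (pair_state R x y) =
    gamma *: complex_mx (pair_state R z w) ->
  let D (p q : G) := eta * (vertex_diff p q (inl i) - vertex_diff p q (inl j))%:~R +
    (vertex_diff p q (inr i) - vertex_diff p q (inr j))%:~R in
  (cos (tau * (eta + 1)) +i* sin (tau * (eta + 1))) * (D x y)%:C =
    gamma * (D z w)%:C.
Proof.
move=> etaE Uu D.
have := transfer_eigen (tr_signless_laplacian R G)
  (prism_eigenvector etaE (sum_point_diff i j)) Uu.
rewrite !vertex_vec_pair_state !prism_fun_pair -/(D x y) -/(D z w) !rmorphM /=.
rewrite !(mulrCA _ (_%:C)); apply: mulfI.
by rewrite (inj_eq (@complexI R) _ 0) invr_eq0 sqrtr_eq0 -ltNge ltr0n.
Qed.

(** With three positions available, one of them lies over neither [x] nor [y]; it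
    is compared with the position of [x], on the copy that contains [x]. *)
Lemma vertex_diff_nonconstant (x y : G) : (2 < n)%N -> x != y ->
  exists i j, vertex_diff x y (inl i) - vertex_diff x y (inl j) != 0 \/
    vertex_diff x y (inr i) - vertex_diff x y (inr j) != 0.
Proof.
move=> n3 xy; rewrite /vertex_diff.
pose idx (t : G) : 'I_n := match t with inl a => a | inr a => a end.
have [j jx jy] := exists_avoid2 (idx x) (idx y) n3.
exists (idx x), j.
have F (t : G) : idx t = j -> (t == x) = false /\ (t == y) = false.
  move=> tj; split; apply/negP => /eqP tE; first by rewrite -tE tj eqxx in jx.
  by rewrite -tE tj eqxx in jy.
have [-> ->] := F (inl j) erefl; have [-> ->] := F (inr j) erefl.
case: x xy {jx F} => a xy; rewrite /idx eqxx (negPf xy); by [left|right].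
Qed.

(** Transfer can only lead back to the same line; it is the irrationality of [eta]
    that separates the two copies in each equation between components. *)
Lemma transfer_target_dependent (x y z w : G) tau gamma : (2 < n)%N ->
  x != y -> z != w -> `|gamma| = 1 ->
  transition_mx Q tau *m complex_mx (pair_state R x y) =
    gamma *: complex_mx (pair_state R z w) ->
  exists e : R, pair_state R z w = e *: pair_state R x y.
Proof.
move=> n3 xy zw g1 Uu.
pose m := (n - 2)%N.
have m0 : (0 < m)%N by rewrite subn_gt0.
have nm : n%:R - 2 = m%:R :> R by rewrite /m natrB// ltnW.
pose s : R := Num.sqrt (m%:R ^+ 2 + 4).
have s2 : s ^+ 2 = m%:R ^+ 2 + 4 by rewrite sqr_sqrtr// addr_ge0 ?sqr_ge0.
pose eta : R := (m%:R + s) / 2.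
have etaE : eta ^+ 2 = m%:R * eta + 1.
  by transitivity ((m%:R ^+ 2 + s ^+ 2 + 2 * m%:R * s) / 4);
    [rewrite /eta; field | rewrite s2 /eta; field].
pose df i j p q := vertex_diff p q (inl i : G) - vertex_diff p q (inl j).
pose dg i j p q := vertex_diff p q (inr i : G) - vertex_diff p q (inr j).
pose d i j (p q : G) : R := eta * (df i j p q)%:~R + (dg i j p q)%:~R.
pose c : R[i] := cos (tau * (eta + 1)) +i* sin (tau * (eta + 1)).
have step i j : c * (d i j x y)%:C = gamma * (d i j z w)%:C.
  by apply: transfer_components Uu; rewrite nm.
have g0 : gamma != 0 by rewrite -normr_eq0 g1 oner_neq0.
pose k := c / gamma.
have kd i j : k * (d i j x y)%:C = (d i j z w)%:C.
  by rewrite /k mulrAC step mulrAC mulfV// mul1r.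
have k1 : `|k| = 1.
  by rewrite normf_div g1 divr1 normc_def /= cos2Dsin2 sqrtr1.
(* A nonzero component of the source fixes the phase ratio [k] once for all. *)
have [i0 [j0 nc]] := vertex_diff_nonconstant n3 xy.
have d0 : d i0 j0 x y != 0.
  by apply/eqP => /(sum_int_eq0 m0 etaE)[f0 h0]; case: nc => /eqP; apply.
have [e e1 ke] := unit_real_ratio k1 (kd i0 j0) d0.
have sgn i j : df i j z w = e * df i j x y /\ dg i j z w = e * dg i j x y.
  have := kd i j; rewrite ke -rmorphM => /(@complexI R) /eqP.
  rewrite eq_sym -subr_eq0 => /eqP dd.
  have : eta * (df i j z w - e * df i j x y)%:~R +
         (dg i j z w - e * dg i j x y)%:~R = 0.
    rewrite -[RHS]dd /d.
    move: (df i j z w) (df i j x y) (dg i j z w) (dg i j x y) => p q p' q'.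
    by rewrite !intrB !intrM; ring.
  by move=> /(sum_int_eq0 m0 etaE)[/eqP + /eqP]; rewrite !subr_eq0 => /eqP ? /eqP.
have Pxy := vertex_diff_pair_like xy; have Pzw := vertex_diff_pair_like zw.
have inlI : injective (inl : 'I_n -> G) by move=> ? ? [].
have inrI : injective (inr : 'I_n -> G) by move=> ? ? [].
have El := pair_like_eq n3 e1 (pair_like_inj inlI Pxy) (pair_like_inj inlI Pzw)
  (fun i j => (sgn i j).1).
have Er := pair_like_eq n3 e1 (pair_like_inj inrI Pxy) (pair_like_inj inrI Pzw)
  (fun i j => (sgn i j).2).
exists e%:~R; rewrite !pair_stateE scalerA mulrC -scalerA; congr (_ *: _).
apply/matrixP => i j; rewrite !mxE -rmorphM /=; congr (_%:~R).
by case: (enum_val i) => a; [exact: El | exact: Er].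
Qed.

Lemma pair_states_dependent_small (x y z w : G) : (n < 2)%N -> x != y -> z != w ->
  exists e : R, pair_state R z w = e *: pair_state R x y.
Proof.
move=> n1.
have all_eq (a b : 'I_n) : a = b.
  by apply: val_inj => /=; have := ltn_ord a; have := ltn_ord b; lia.
have swap (p q : G) : pair_state R q p = - pair_state R p q.
  by rewrite /pair_state -scalerN opprB.
case: x => a; case: y => b; rewrite (all_eq b a) ?eqxx// => _;
  case: z => p; case: w => q; rewrite (all_eq p a) (all_eq q a) ?eqxx// => _.
- by exists 1; rewrite scale1r.
- by exists (-1); rewrite scaleN1r swap.
- by exists (-1); rewrite scaleN1r swap.
- by exists 1; rewrite scale1r.
Qed.

End Prism.

Lemma pair_state_unit (R : realType) (G : sgraph) (x y : G) : x != y ->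
  unit_vec (pair_state R x y).
Proof.
move=> xy; rewrite /unit_vec; pose h t : R := (vertex_diff x y t)%:~R.
have -> : \sum_j pair_state R x y j 0 ^+ 2 =
    (Num.sqrt 2)^-1 * ((vertex_vec h)^T *m pair_state R x y) 0 0.
  rewrite [in LHS]pair_stateE [in RHS]mxE mulr_sumr; apply: eq_bigr => j _.
  by rewrite pair_stateE !mxE; ring.
rewrite vertex_vec_pair_state mulrA -expr2 exprVn sqr_sqrtr ?ler0n//.
rewrite /h /vertex_diff !eqxx (eq_sym y) (negPf xy) /= subr0 sub0r mulrN1z opprK.
by rewrite mulr1z -[1 + 1]/(2%:R) mulVf ?pnatr_eq0.
Qed.

Lemma not_free_scale (R : realType) (N : nat) (u : 'cV[R]_N) (e : R) :
  ~~ free [:: u; e *: u].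
Proof.
rewrite (perm_free (Y := [:: e *: u; u])); last by rewrite (perm_catC [:: u]).
by rewrite free_cons span_seq1 memvZ ?memv_line.
Qed.

(** The graph is the path on four vertices; the transfer is from the difference of
    the two inner vertices to that of the two end vertices. *)
Lemma transfer_prism2 (R : realType) : admits_perfect_pair_state_transfer
  (signless_laplacian R (complementary_prism (complete_graph 2))).
Proof.
set G := complementary_prism _.
pose i0 : 'I_2 := 0; pose i1 : 'I_2 := 1.
pose x : G := inl i0; pose y : G := inl i1.
pose z : G := inr i0; pose w : G := inr i1.
exists x, y, z, w; split=> //.
pose D : 'I_2 -> R := point_diff R i0 i1.
pose wp : 'cV[R]_#|G| := vertex_vec (prism_fun 1 D).
pose wm : 'cV[R]_#|G| := vertex_vec (prism_fun (-1) D).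
have uE : pair_state R x y = ((Num.sqrt 2)^-1 / 2) *: (wp - wm).
  rewrite pair_stateE -scalerA; congr (_ *: _).
  apply/matrixP => i j; rewrite !mxE.
  rewrite /vertex_diff rmorphB /= !mulrz_nat.
  by case: (enum_val i) => a; rewrite /eq_op /= /D /point_diff; field.
have vE : pair_state R z w = ((Num.sqrt 2)^-1 / 2) *: (wp + wm).
  rewrite pair_stateE -scalerA; congr (_ *: _).
  apply/matrixP => i j; rewrite !mxE.
  rewrite /vertex_diff rmorphB /= !mulrz_nat.
  by case: (enum_val i) => a; rewrite /eq_op /= /D /point_diff; field.
split.
- exact: pair_state_unit.
- exact: pair_state_unit.
- rewrite free_cons seq1_free span_seq1.
  have s0 : (Num.sqrt 2)^-1 != 0 :> R by rewrite invr_eq0 sqrtr_eq0 -ltNge ltr0n.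
  apply/andP; split.
    apply/negP => /vlineP[k] /matrixP/(_ (enum_rank x) 0).
    rewrite !pair_stateE !mxE enum_rankK /vertex_diff /eq_op /= subr0 !mulr0.
    by move/eqP; rewrite mulr1 (negPf s0).
  apply/eqP => /matrixP/(_ (enum_rank z) 0).
  rewrite !pair_stateE !mxE enum_rankK /vertex_diff /eq_op /= subr0.
  by move/eqP; rewrite mulr1 (negPf s0).
- exists (pi / 2), (-1); split; first by rewrite divr_gt0 ?pi_gt0.
    by rewrite normrN1.
  have wpE := @prism_eigenvector R 2 1 D _ (sum_point_diff R i0 i1).
  have wmE := @prism_eigenvector R 2 (-1) D _ (sum_point_diff R i0 i1).
  rewrite uE vE /complex_mx !map_mxZ map_mxB map_mxD -scalemxAr mulmxBr.
  rewrite [X in X - _](transition_mx_eigen _ (wpE _)); last by ring.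
  rewrite [X in _ - X](transition_mx_eigen _ (wmE _)); last by ring.
  rewrite addNr mulr0 cos0 sin0 (_ : pi / 2 * (1 + 1) = pi); last by field.
  rewrite cospi sinpi [RHS]scalerA [in RHS]mulrC -[RHS]scalerA; congr (_ *: _).
  rewrite (_ : -1 +i* 0 = -1); last by rewrite -[RHS](rmorphN1 (real_complex R)).
  by rewrite scale1r !scaleN1r opprD.
Qed.

Theorem theorem12 (R : realType) (n : nat) :
  admits_perfect_pair_state_transfer
    (signless_laplacian R (complementary_prism (complete_graph n)))
  <-> n = 2%N.
Proof.
split=> [[x [y [z [w [xy zw [_ _ uv [tau [gamma [_ g1 Uu]]]]]]]]]|->].
  have [n2|n2|//] := ltngtP n 2.
    have [e vE] := pair_states_dependent_small R n2 xy zw.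
    by move: uv; rewrite vE (negPf (not_free_scale _ _)).
  have [e vE] := transfer_target_dependent n2 xy zw g1 Uu.
  by move: uv; rewrite vE (negPf (not_free_scale _ _)).
exact: transfer_prism2.
Qed.
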